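(* For all $\Gamma\subseteq\{0,1\}^\infty$, $$\dim_H(\Gamma)=\inf \mathscr G(\Gamma),$$ where $\mathscr G(\Gamma)=\{s\in(0,\infty) : \text{there exists a learning function } l \text{ which } s\text{-learns every } X\in\Gamma\}$.
   Context: $\dim_H$ denotes the Hausdorff dimension on the Cantor space $\{0,1\}^\infty$ (with respect to the standard metric, equivalently defined via covers by cylinders $C_w=\{Y: w\sqsubseteq Y\}$ with weight $2^{-s|w|}$). A learning function is a function $l:\{0,1\}^*\to\{0,1\}$ (identifying yes with $1$ and no with $0$). $Y\upharpoonright i$ is the length-$i$ prefix of $Y$; $\lambda$ is the uniform (Lebesgue) measure on $\{0,1\}^\infty$. For a nonempty string $w$, the path average is $\mathrm{AVG}_l(w)=\frac{1}{|w|}\sum_{i=0}^{|w|} l(w\upharpoonright i)$. A learning function $l$ satisfies the measure condition if for all $n\in\mathbb N$, $\lambda(\{Y\in\{0,1\}^\infty : \#\{i\in\mathbb N: l(Y\upharpoonright i)=1\}\ge n\})\le 2^{-n}$. For $s\ge0$, $l$ $s$-learns $X$ iff $l$ satisfies the measure condition and $\limsup_{n\to\infty}\mathrm{AVG}_l(X\upharpoonright n)\ge 1-s$ (no computability restriction on $l$). *)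

(* Defs.v *)
From HB Require Import structures.
From mathcomp Require Import all_boot all_order all_algebra.
From mathcomp Require Import all_classical all_reals all_analysis.
Set Implicit Arguments. Unset Strict Implicit. Unset Printing Implicit Defensive.
Import Order.TTheory GRing.Theory Num.Theory.
Local Open Scope classical_set_scope.
Local Open Scope ring_scope.

Definition cantor := nat -> bool.
Definition bstring := seq bool.

Definition prefix (Y : cantor) (i : nat) : bstring := mkseq Y i.

Definition cyl (w : bstring) : set cantor := [set Y | prefix Y (size w) = w].

(* A countable family of cylinders (None = no cylinder) covers A with
   total weight sum_i 2^{-s|w_i|} at most r. *)
Definition wt (R : realType) (s : R) (c : option bstring) : R :=
  if c is Some w then powR 2 (- (s * (size w)%:R)) else 0.

Definition cover_bounded (R : realType) (s : R) (A : set cantor) (r : R) :=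
  exists C : nat -> option bstring,
    (forall Y, A Y -> exists i w, C i = Some w /\ cyl w Y) /\
    (forall N, \sum_(i < N) wt s (C i) <= r).

(* Lebesgue (uniform) measure on Cantor space, as the outer measure
   generated by cylinders: lambda A = inf of the weights of cylinder covers
   with s = 1 (weight 2^{-|w|} = lambda(C_w)). *)
Definition lambda (R : realType) (A : set cantor) : R :=
  inf [set r : R | cover_bounded 1 A r].

Definition Hnull (R : realType) (s : R) (A : set cantor) :=
  forall e : R, 0 < e -> cover_bounded s A e.

Definition dimH (R : realType) (A : set cantor) : R :=
  inf [set s : R | 0 <= s /\ Hnull s A].

Definition learning_fun := bstring -> bool.

Definition AVG (R : realType) (l : learning_fun) (w : bstring) : R :=
  (size w)%:R^-1 * \sum_(i < (size w).+1) (l (take i w))%:R.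

Definition at_least_yes (l : learning_fun) (n : nat) : set cantor :=
  [set Y | exists k, (n <= \sum_(i < k) (l (prefix Y i) : nat))%N].

Definition measure_condition (R : realType) (l : learning_fun) :=
  forall n : nat, lambda R (at_least_yes l n) <= 2%:R ^- n.

Definition s_learns (R : realType) (l : learning_fun) (s : R) (X : cantor) :=
  measure_condition R l /\
  ((1 - s)%:E <= limn_esup (fun n => (AVG R l (prefix X n))%:E))%E.

Definition learnG (R : realType) (Gamma : set cantor) : set R :=
  [set s : R | 0 < s /\ exists l : learning_fun,
       forall X, Gamma X -> s_learns l s X].

Arguments lambda R A : clear implicits.
Arguments dimH R A : clear implicits.
Arguments learnG R Gamma : clear implicits.

(* Main.v *)
(** [dimH <= inf learnG]: by compactness of the Cantor space, the measure
    condition bounds by [2 ^ n * 2 ^ (- a n)] the number of strings of length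
    [n] along which a learner says yes at least [a n] times.  If [l] [s]-learns
    [X] and [a < 1 - s], then [X] has infinitely many such prefixes, and these
    strings have summable [s']-weight as soon as [s' > 1 - a].

    [inf learnG <= dimH]: if [Gamma] is [s]-null, merging covers of total weight
    [2 ^ (- k - 1)] gives a set [W] of strings of total [s]-weight at most 1
    containing infinitely many prefixes of each [X] in [Gamma].  Let [mu u] be
    the total [s]-weight of the extensions of [u] in [W].  The supermartingale
    [M u = 2 ^ |u| * mu u] at most doubles at each step, and is at least
    [2 ^ ((1 - s) |w|)] on [W].  The learner that says yes whenever the running
    maximum of [M] passes a new power of 2 satisfies the measure condition by
    Ville's inequality, and it says yes about [(1 - s) |w|] times along each
    [w] in [W]. *)

Require Import Defs.
From mathcomp Require Import all_boot all_order all_algebra.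
From mathcomp Require Import all_classical all_reals all_analysis.
From mathcomp Require Import ring lra.
Set Implicit Arguments. Unset Strict Implicit. Unset Printing Implicit Defensive.
Import Order.TTheory GRing.Theory Num.Theory.
Local Open Scope classical_set_scope.
Local Open Scope ring_scope.

Local Notation pre := Defs.prefix.

(** * Prefixes, and finite lists of strings *)

Lemma size_pre Y n : size (pre Y n) = n.
Proof. exact: size_mkseq. Qed.

Lemma preS Y n : pre Y n.+1 = rcons (pre Y n) (Y n).
Proof. exact: mkseqS. Qed.

Lemma take_pre Y i n : (i <= n)%N -> take i (pre Y n) = pre Y i.
Proof. by move=> ?; rewrite /pre /mkseq -map_take take_iota (minn_idPl _). Qed.

(** Finite lists exhausting all strings: an infinite sum of nonnegative weights is bounded by
    bounding its sums over every [strs L]. *)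
Fixpoint strs (L : nat) : seq bstring :=
  if L is L'.+1 then
    [::] :: map (cons false) (strs L') ++ map (cons true) (strs L')
  else [::].

Lemma mem_strs L w : (w \in strs L) = (size w < L)%N.
Proof.
elim: L w => [|L IH] [|b w] //=; rewrite inE /= mem_cat ltnS -IH.
have inj (c : bool) : injective (cons c : bstring -> bstring) by move=> ? ? [].
have disj s : (b :: w \in map (cons (~~ b)) s) = false.
  by apply/mapP => -[x _ []]; case: b.
by case: b disj => /= ->; rewrite ?orbF mem_map.
Qed.

Lemma strs_uniq L : uniq (strs L).
Proof.
elim: L => //= L IH; apply/andP; split.
  by rewrite mem_cat; apply/norP; split; apply/mapP => -[].
rewrite cat_uniq !map_inj_uniq ?IH ?andbT //=; try by move=> ? ? [].
by apply/hasPn => _ /mapP[x _ ->]; apply/mapP => -[].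
Qed.

Lemma strsS L :
  strs L.+1 = [::] :: map (cons false) (strs L) ++ map (cons true) (strs L).
Proof. by []. Qed.

Arguments strs : simpl never.

(** * Finite weight sums and compactness *)

Section Sums.
Context {R : realType}.
Implicit Types (P : pred bstring) (F : bstring -> R).

Lemma big_strsS L P F : \sum_(w <- strs L.+1 | P w) F w =
  (if P [::] then F [::] else 0)
  + (\sum_(w <- strs L | P (false :: w)) F (false :: w)
     + \sum_(w <- strs L | P (true :: w)) F (true :: w)).
Proof.
rewrite strsS big_cons big_cat !big_map /=.
by case: (P [::]); rewrite ?add0r.
Qed.

Lemma ler_sum_uniq (I : eqType) (r1 r2 : seq I) (P : pred I) (F : I -> R) :
  uniq r1 -> uniq r2 -> {subset [seq i <- r1 | P i] <= r2} ->
  (forall i, P i -> 0 <= F i) ->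
  \sum_(i <- r1 | P i) F i <= \sum_(i <- r2 | P i) F i.
Proof.
move=> u1 u2 sub F0.
rewrite -big_filter -[leRHS]big_filter.
rewrite [leRHS](bigID (mem [seq i <- r1 | P i])) /= -[X in _ <= X + _]big_filter.
rewrite (@perm_big _ _ _ _ [seq i <- r1 | P i]
  [seq i <- [seq i <- r2 | P i] | i \in [seq i <- r1 | P i]]).
  rewrite lerDl big_seq_cond sumr_ge0 // => i.
  by rewrite mem_filter => /andP[/andP[/F0]].
apply: uniq_perm; rewrite ?filter_uniq // => x.
rewrite [RHS]mem_filter.
have [xr1|//] := boolP (x \in [seq i <- r1 | P i]).
by rewrite mem_filter sub ?andbT //; move: xr1; rewrite mem_filter => /andP[->].
Qed.

Lemma ler_sum_strs L L' P F : (forall w, P w -> 0 <= F w) -> (L <= L')%N ->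
  \sum_(w <- strs L | P w) F w <= \sum_(w <- strs L' | P w) F w.
Proof.
move=> F0 LL; apply: ler_sum_uniq; rewrite ?strs_uniq // => w.
by rewrite mem_filter !mem_strs => /andP[_ /leq_trans]; apply.
Qed.

Lemma pow2_gt0 n : (0 : R) < 2 ^- n.
Proof. by rewrite invr_gt0 exprn_gt0. Qed.

Lemma pow2_cons (b : bool) w : (2 ^- size (b :: w) : R) = 2^-1 * 2 ^- size w.
Proof. by rewrite /= exprS invfM. Qed.

(** Koenig's lemma: if no finite part of [P] has full weight below a string, the same holds for one
    of its children, and following such children gives a sequence with no prefix in [P]. *)
Lemma cover_all_weight_ge1 P : (forall Y, exists n, P (pre Y n)) ->
  exists L, (1 : R) <= \sum_(v <- strs L | P v) 2 ^- size v.
Proof.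
(* [Q u]: finitely many members of [P] extending [u] have total weight at least 1 relative to the
   cylinder of [u]. *)
move=> covP; pose Q u := exists L,
  (1 : R) <= \sum_(v <- strs L | P (u ++ v)) 2 ^- size v.
change (Q [::]); apply: contrapT => nQ0.
have PQ u : P u -> Q u.
  move=> Pu; exists 1; rewrite big_strsS cats0 Pu !big_nil addr0 addr0.
  by rewrite expr0 invr1.
have QQ u : Q (rcons u false) -> Q (rcons u true) -> Q u.
  move=> [L1 H1] [L2 H2]; exists (maxn L1 L2).+1.
  rewrite big_strsS.
  have half b L : (1 : R) <= \sum_(v <- strs L | P (rcons u b ++ v)) 2 ^- size v ->
      (L <= maxn L1 L2)%N ->
      2^-1 <= \sum_(w <- strs (maxn L1 L2) | P (u ++ b :: w)) 2 ^- size (b :: w) :> R.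
    move=> HL Lm; under eq_bigl do rewrite -cat_rcons.
    under eq_bigr do rewrite pow2_cons.
    rewrite -big_distrr /= ler_peMr ?invr_ge0 //.
    apply: le_trans HL _; apply: ler_sum_strs => // w _; exact/ltW/pow2_gt0.
  have := half _ _ H1 (leq_maxl _ _); have := half _ _ H2 (leq_maxr _ _).
  have : (0 : R) <= if P (u ++ [::]) then 2 ^- size ([::] : bstring) else 0.
    by case: ifP => // _; exact/ltW/pow2_gt0.
  move: (if _ then _ else _) => x; lra.
(* If [Q] fails at [u], it fails at the child chosen by [b u]. *)
pose b u := `[< Q (rcons u false) >].
have nQ u : ~ Q u -> ~ Q (rcons u (b u)).
  rewrite /b; case: asboolP => // Q0 nQu Q1; exact: nQu (QQ _ Q0 Q1).
pose f k := iter k (fun u => rcons u (b u)) [::].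
have nQf k : ~ Q (f k) by elim: k => //= k; exact: nQ.
have prf k : pre (fun i => b (f i)) k = f k by elim: k => //= k IH; rewrite preS IH.
by have [n] := covP (fun i => b (f i)); rewrite prf => /PQ /nQf.
Qed.

Lemma weight_level n : \sum_(w <- strs n.+1 | size w == n) 2 ^- size w = 1 :> R.
Proof.
elim: n => [|n IH]; first by rewrite big_strsS !big_nil /= expr0 invr1 !addr0.
rewrite big_strsS add0r.
under eq_bigr do rewrite pow2_cons.
rewrite -!big_distrr /=.
under eq_bigl do rewrite eqSS.
rewrite IH; lra.
Qed.

(* The cover [P] together with the level-[n] strings outside [D] covers the
   whole space, so its total weight is at least 1. *)
Lemma weight_level_le P (D : pred bstring) n (r : R) :
  (forall Y, D (pre Y n) -> exists i, P (pre Y i)) ->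
  (forall L, \sum_(v <- strs L | P v) 2 ^- size v <= r) ->
  \sum_(w <- strs n.+1 | (size w == n) && D w) 2 ^- size w <= r.
Proof.
move=> covP Pr.
pose E := [pred w | (size w == n) && ~~ D w].
have [Y|L HL] := @cover_all_weight_ge1 (predU P E).
  have [DY|DY] := boolP (D (pre Y n)).
    by have [i Pi] := covP _ DY; exists i; rewrite /= Pi.
  by exists n; rewrite /= size_pre eqxx DY orbT.
have := weight_level n; rewrite (bigID D) /= => HS.
have EL : \sum_(w <- strs L | E w) 2 ^- size w <=
    \sum_(w <- strs n.+1 | E w) 2 ^- size w :> R.
  apply: ler_sum_uniq; rewrite ?strs_uniq // => w.
  by rewrite mem_filter !mem_strs => /andP[/andP[/eqP-> _] _].
have UL : \sum_(w <- strs L | predU P E w) 2 ^- size w <=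
    \sum_(w <- strs L | P w) 2 ^- size w + \sum_(w <- strs L | E w) 2 ^- size w :> R.
  rewrite [leLHS]big_mkcond [X in _ <= X + _]big_mkcond.
  rewrite [X in _ <= _ + X]big_mkcond -big_split /=; apply: ler_sum => w _.
  have := pow2_gt0 (size w).
  by case: (P w) (size w == n) (D w) => -[] [] /=; lra.
have := Pr L; move: HL EL UL HS; rewrite /E /=; lra.
Qed.

End Sums.

(** * Covers as sequences and as sets of strings *)

Section Covers.
Context {R : realType}.
Implicit Types (P : pred bstring) (A : set cantor) (s r : R).

(** The [pickle] numbering lists each string at most once, so partial sums of the sequence are sums
    over distinct members of [P]. *)
Lemma cover_bounded_pred s A r P :
  (forall Y, A Y -> exists n, P (pre Y n)) ->
  (forall L, \sum_(w <- strs L | P w) 2 `^ (- (s * (size w)%:R)) <= r) ->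
  cover_bounded s A r.
Proof.
move=> covP Pr.
pose C i := if pickle_inv i is Some w then if P w then Some w else None
            else None : option bstring.
exists C; split=> [Y /covP[n Pn]|N].
  exists (pickle (pre Y n)), (pre Y n).
  by rewrite /C pickleK_inv Pn /cyl /= size_pre.
pose t := pmap (pickle_inv : nat -> option bstring) (iota 0 N).
have ut : uniq t by apply: (pmap_uniq pickle_invK); rewrite iota_uniq.
have -> : \sum_(i < N) wt s (C i) = \sum_(w <- t | P w) 2 `^ (- (s * (size w)%:R)).
  rewrite -(big_mkord xpredT (fun i => wt s (C i))) /index_iota subn0 /t.
  elim: (iota 0 N) => [|i q IH]; first by rewrite !big_nil.
  rewrite big_cons IH /= /C; case: (pickle_inv i) => [w|] /=; rewrite ?add0r //.
  by rewrite big_cons; case: ifP => //=; rewrite add0r.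
apply: le_trans (Pr (\max_(w <- t) size w).+1).
apply: ler_sum_uniq; rewrite ?strs_uniq // => w.
rewrite mem_filter mem_strs => /andP[_ wt].
by rewrite ltnS; apply: (leq_bigmax_seq w).
Qed.

(** Repetitions in the sequence count once in the set: choosing one index [f w] per string injects
    the set into the indices. *)
Lemma pred_cover_bounded s A r : cover_bounded s A r ->
  exists P, (forall Y, A Y -> exists n, P (pre Y n)) /\
  forall L, \sum_(w <- strs L | P w) 2 `^ (- (s * (size w)%:R)) <= r.
Proof.
move=> [C [covC Cr]].
exists (fun w => `[< exists i, C i = Some w >]); split=> [Y AY|L].
  have [i [w [Cw wY]]] := covC _ AY; exists (size w).
  by apply/asboolP; exists i; rewrite wY.
have [f fP] : {f : bstring -> nat & forall w, (exists i, C i = Some w) -> C (f w) = Some w}.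
  apply: (@choice _ _ (fun w j => (exists i, C i = Some w) -> C j = Some w)) => w.
  by have [[i Ci]|nC] := pselect (exists i, C i = Some w); [exists i|exists 0%N].
rewrite -big_filter; set t := [seq _ <- _ | _].
have tP w : w \in t -> C (f w) = Some w.
  by rewrite mem_filter => /andP[/asboolP/fP].
have -> : \sum_(w <- t) 2 `^ (- (s * (size w)%:R)) = \sum_(i <- map f t) wt s (C i).
  by rewrite big_map big_seq [RHS]big_seq; apply: eq_bigr => w /tP ->.
apply: le_trans (Cr (\max_(i <- map f t) i).+1).
rewrite -(big_mkord xpredT (fun i => wt s (C i))).
apply: ler_sum_uniq => [||i|i _]; rewrite ?iota_uniq //.
- rewrite map_inj_in_uniq ?filter_uniq ?strs_uniq // => v w /tP vt /tP wt e.
  by move: vt; rewrite e wt => -[].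
- rewrite mem_filter mem_index_iota ltnS => it; exact: (leq_bigmax_seq i).
- by case: (C i) => //= w; exact: powR_ge0.
Qed.

Lemma powR2_1 n : (2 : R) `^ (- (1 * n%:R)) = 2 ^- n.
Proof. by rewrite mul1r powRN powR_mulrn. Qed.

Lemma cover_bounded_ge0 s A r : cover_bounded s A r -> 0 <= r.
Proof. by case=> C [_ /(_ 0%N)]; rewrite big_ord0. Qed.

Lemma cover_bounded_le s A r r' : r <= r' ->
  cover_bounded s A r -> cover_bounded s A r'.
Proof. by move=> rr [C [cC Cr]]; exists C; split=> // N; exact: le_trans rr. Qed.

(** A single cylinder, the whole space; hence the infimum defining [lambda] is over a nonempty
    set. *)
Lemma cover_bounded1 A : cover_bounded (1 : R) A 1.
Proof.
apply: (@cover_bounded_pred _ _ _ (pred1 [::])) => [Y _|[|L]].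
- by exists 0%N.
- by rewrite /strs big_nil.
by rewrite big_strsS /= !big_pred0 ?addr0 // powR2_1 invr1.
Qed.

Lemma lambda_le A r : cover_bounded 1 A r -> lambda R A <= r.
Proof. by move=> c; apply: ge_inf => //; exists 0 => x; exact: cover_bounded_ge0. Qed.

Lemma lambda_lt A r : lambda R A < r -> cover_bounded 1 A r.
Proof.
move=> /inf_lt[|r' c /ltW rr]; last exact: cover_bounded_le c.
by exists 1; exact: cover_bounded1.
Qed.

Lemma weight_level_lambda A (D : pred bstring) n :
  (forall Y, D (pre Y n) -> A Y) ->
  \sum_(w <- strs n.+1 | (size w == n) && D w) 2 ^- size w <= lambda R A.
Proof.
move=> DA; apply/ler_addgt0Pr => e e0.
have lam : lambda R A < lambda R A + e by rewrite ltrDl.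
have [P [covP Pr]] := pred_cover_bounded (lambda_lt lam).
apply: (@weight_level_le _ P) => [Y /DA/covP //|L].
by under eq_bigr do rewrite -powR2_1.
Qed.

End Covers.

(** * From a learner to null covers *)

Section LearningToNull.
Context {R : realType}.
Implicit Types (P : pred bstring) (A Gamma : set cantor) (s a q : R) (l : learning_fun).

Lemma sum_strs_by_size L P (F : bstring -> R) :
  \sum_(w <- strs L | P w) F w =
  \sum_(n < L) \sum_(w <- strs n.+1 | (size w == n) && P w) F w.
Proof.
elim: L => [|L IH]; first by rewrite big_ord0 /strs big_nil.
rewrite big_ord_recr /= -IH (bigID (fun w => size w == L)) /= addrC; congr (_ + _).
  rewrite -big_filter -[RHS]big_filter; apply: perm_big; apply: uniq_perm.
  - by rewrite filter_uniq ?strs_uniq.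
  - by rewrite filter_uniq ?strs_uniq.
  move=> w; rewrite !mem_filter !mem_strs ltnS ltn_neqAle.
  by case: (P w) (size w == L) => -[].
by apply: eq_bigl => w; rewrite andbC.
Qed.

Lemma geometric_tail_le q N L : 0 <= q < 1 ->
  \sum_(n < L | (N <= n)%N) q ^+ n <= q ^+ N / (1 - q).
Proof.
move=> /andP[q0 q1]; rewrite ler_pdivlMr ?subr_gt0 //.
(* The sum telescopes; [maxn] handles [L <= N], where it is empty. *)
suff -> : (\sum_(n < L | (N <= n)%N) q ^+ n) * (1 - q) = q ^+ N - q ^+ maxn N L.
  by rewrite gerBl exprn_ge0.
elim: L => [|L IH]; first by rewrite big_ord0 maxn0 subrr mul0r.
rewrite big_mkcond big_ord_recr /= mulrDl -big_mkcond IH.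
case: leqP => NL.
  by rewrite !(maxn_idPr _) ?(leqW NL) // exprS; ring.
by rewrite mul0r addr0 !(maxn_idPl _) // ltnW.
Qed.

Lemma expr_small q (e : R) : 0 <= q < 1 -> 0 < e -> exists N, q ^+ N < e.
Proof.
move=> /andP[q0 q1] e0.
have nq : `|q| < 1 by rewrite ger0_norm.
have /cvgrPdist_lt/(_ _ e0)[N _ /(_ N (leqnn N)) qN] := cvg_expr nq.
by exists N; move: qN; rewrite /= sub0r normrN ger0_norm // exprn_ge0.
Qed.

Lemma powR2_lt1 s : 0 < s -> 2 `^ (- s) < 1.
Proof.
move=> s0; rewrite /powR pnatr_eq0 /= expR_lt1 mulNr oppr_lt0.
by rewrite mulr_gt0 // ln_gt0 // ltr1n.
Qed.

Lemma powR2_weight s n :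
  2 `^ (- (s * n%:R)) = (2 `^ (1 - s)) ^+ n * 2 ^- n.
Proof.
rewrite -powR_mulrn ?powR_ge0 // -powRrM.
rewrite -[2 ^- n]powR2_1 -powRD ?pnatr_eq0 ?implybT //.
by congr powR; ring.
Qed.

(** The strings of length [n] cover everything with weight [(2 ^ (1 - s)) ^ n], which tends to 0. *)
Lemma Hnull_gt1 A s : 1 < s -> Hnull s A.
Proof.
move=> s1 e e0.
have q01 : 0 <= 2 `^ (1 - s) < 1.
  by rewrite powR_ge0 -opprB powR2_lt1 // subr_gt0.
have [n ne] := expr_small q01 e0.
apply: (@cover_bounded_pred _ _ _ _ (fun w => size w == n)) => [Y _|L].
  by exists n; rewrite size_pre.
apply: le_trans (ltW ne).
apply: (@le_trans _ _ (\sum_(w <- strs n.+1 | size w == n) 2 `^ (- (s * (size w)%:R)))).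
  apply: ler_sum_uniq; rewrite ?strs_uniq // => w.
  by rewrite mem_filter !mem_strs => /andP[/eqP-> _].
have -> : \sum_(w <- strs n.+1 | size w == n) 2 `^ (- (s * (size w)%:R)) =
    \sum_(w <- strs n.+1 | size w == n) (2 `^ (1 - s)) ^+ n * 2 ^- size w.
  by apply: eq_bigr => w /eqP <-; exact: powR2_weight.
by rewrite -big_distrr /= weight_level mulr1.
Qed.

Definition count_yes l w : nat := (\sum_(i < (size w).+1) l (take i w))%N.

Lemma count_yes_pre l Y n :
  count_yes l (pre Y n) = (\sum_(i < n.+1) l (pre Y i))%N.
Proof.
rewrite /count_yes size_pre; apply: eq_bigr => i _.
by rewrite take_pre // -ltnS.
Qed.

Lemma AVG_count_yes l w : AVG R l w = (count_yes l w)%:R / (size w)%:R.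
Proof. by rewrite /AVG mulrC /count_yes natr_sum. Qed.

Lemma weight_count_yes_ge l a n : measure_condition R l ->
  \sum_(w <- strs n.+1 | (size w == n) && (a * n%:R <= (count_yes l w)%:R))
    2 ^- size w <= 2 `^ (- (a * n%:R)).
Proof.
move=> ml.
have ex : exists k, a * n%:R <= k%:R.
  by exists (Num.bound (a * n%:R)); exact/ltW/unstable.ltr_bound.
(* [k] is the ceiling of [a * n], or 0 if that is negative; an integer count reaching [a * n]
   reaches [k]. *)
case: (ex_minnP ex) => k ak kmin.
apply: (@le_trans _ _ (2 ^- k)); last first.
  by rewrite powRN lef_pV2 ?posrE ?powR_gt0 ?exprn_gt0 // -powR_mulrn // ler_powR // ler1n.
apply: le_trans (ml k); apply: weight_level_lambda => Y aY.
by exists n.+1; rewrite -count_yes_pre; exact: kmin.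
Qed.

Lemma s_learns_often l s a X N : s_learns l s X -> a < 1 - s ->
  exists n, (N <= n)%N /\ a * n%:R <= (count_yes l (pre X n))%:R.
Proof.
move=> [_ supl] as1.
(* Starting the tail at [N.+1] keeps [n] positive, so the average can be multiplied by it. *)
have : (a%:E < ereal_sup ((fun n => (AVG R l (pre X n))%:E) @` [set n | (N.+1 <= n)%N]))%E.
  apply: (@lt_le_trans _ _ (1 - s)%:E); first by rewrite lte_fin.
  apply: (le_trans supl); apply: ereal_inf_lbound.
  by exists [set n | (N.+1 <= n)%N] => //; exact: nbhs_infty_ge.
move=> /ereal_sup_gt[_ [n /= Nn <-]]; rewrite lte_fin AVG_count_yes size_pre => /ltW.
rewrite ler_pdivlMr ?ltr0n ?(leq_ltn_trans _ Nn) // => an.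
by exists n; split => //; exact: ltnW.
Qed.

Lemma learnG_Hnull Gamma s s' : learnG R Gamma s -> s < s' -> Hnull s' Gamma.
Proof.
move=> [s0 [l lP]] ss' e e0.
(* The measure condition is obtained from a member of [Gamma]; the empty set is covered by no
   strings. *)
have [[X0 GX0]|G0] := pselect (Gamma !=set0); last first.
  apply: (@cover_bounded_pred _ _ _ _ pred0) => [Y GY|L]; first by case: G0; exists Y.
  by rewrite big_pred0 ?ltW.
have [ml _] := lP _ GX0.
(* [a] is the midpoint of [1 - s'] and [1 - s]: below [1 - s], so infinitely many prefixes qualify,
   and [d] above [1 - s'], so level [n] has [s']-weight at most [2 ^ (- d n)]. *)
pose d := (s' - s) / 2; pose a := 1 - s' + d.
have d0 : 0 < d by rewrite divr_gt0 ?subr_gt0.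
have as1 : a < 1 - s by rewrite /a /d; lra.
pose q := 2 `^ (- d).
have q01 : 0 <= q < 1 by rewrite powR_ge0 powR2_lt1.
have q1 : 0 < 1 - q by case/andP: q01 => _; rewrite subr_gt0.
have [N qN] := expr_small q01 (mulr_gt0 e0 q1).
pose D w := (N <= size w)%N && (a * (size w)%:R <= (count_yes l w)%:R).
apply: (@cover_bounded_pred _ _ _ _ D) => [X GX|L].
  have [n [Nn an]] := s_learns_often N (lP _ GX) as1.
  by exists n; rewrite /D size_pre Nn.
rewrite sum_strs_by_size.
apply: (@le_trans _ _ (\sum_(n < L | (N <= n)%N) q ^+ n)); last first.
  by apply: (le_trans (geometric_tail_le _ _ q01)); rewrite ler_pdivrMr // ltW.
rewrite [leRHS]big_mkcond; apply: ler_sum => n _; case: ifPn => Nn; last first.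
  rewrite big_pred0 // => w; apply/negP => /andP[/eqP wn].
  by rewrite /D wn (negbTE Nn).
have -> : \sum_(w <- strs n.+1 | (size w == n) && D w) 2 `^ (- (s' * (size w)%:R)) =
  (2 `^ (1 - s')) ^+ n * \sum_(w <- strs n.+1 |
    (size w == n) && (a * n%:R <= (count_yes l w)%:R)) 2 ^- size w.
  rewrite big_distrr /=; apply: eq_big => [w|w /andP[/eqP<- _]]; last exact: powR2_weight.
  by rewrite /D; case: eqP => // ->; rewrite Nn.
have -> : q ^+ n = (2 `^ (1 - s')) ^+ n * 2 `^ (- (a * n%:R)).
  rewrite -!powR_mulrn ?powR_ge0 // -!powRrM -powRD ?pnatr_eq0 ?implybT //.
  by congr powR; rewrite /a; ring.
by rewrite ler_wpM2l ?exprn_ge0 ?powR_ge0 //; exact: weight_count_yes_ge.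
Qed.

End LearningToNull.

(** * Supermartingales and the doubling learner *)

Section Supermartingales.
Context {R : realType}.
Implicit Types (mu M F : bstring -> R) (V : pred bstring).

(** A Kraft inequality, by induction on depth: if [u] is in [V], its term is the only one; otherwise
    the sum splits between the children. *)
Lemma prefix_free_sum_le mu V : (forall u, 0 <= mu u) ->
  (forall u, mu (rcons u false) + mu (rcons u true) <= mu u) ->
  (forall v w, V v -> V (v ++ w) -> w = [::]) ->
  forall L u, \sum_(v <- strs L | V (u ++ v)) mu (u ++ v) <= mu u.
Proof.
move=> mu0 musup Vfree; elim=> [|L IH] u; first by rewrite /strs big_nil.
rewrite big_strsS cats0; case: ifPn => Vu.
  rewrite !big_pred0 ?addr0 // => w; by apply/negP => /(Vfree _ _ Vu).
rewrite add0r; under eq_bigl do rewrite -cat_rcons.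
under eq_bigr do rewrite -cat_rcons.
under [X in _ + X]eq_bigl do rewrite -cat_rcons.
under [X in _ + X]eq_bigr do rewrite -cat_rcons.
exact: le_trans (lerD (IH _) (IH _)) (musup u).
Qed.

(** With [F] the [s]-weight on [W], this is the overview's [mu]. *)
Definition ext_mass F u : R :=
  sup [set \sum_(v <- strs L) F (u ++ v) | L in [set: nat]].

Section ExtMass.
Variable F : bstring -> R.
Hypothesis F0 : forall w, 0 <= F w.
Hypothesis F1 : forall L, \sum_(w <- strs L) F w <= 1.

(** The strings [u ++ v] are distinct and shorter than [size u + L], so their sum is part of one at
    the root. *)
Lemma ext_mass_has_ubound u :
  has_ubound [set \sum_(v <- strs L) F (u ++ v) | L in [set: nat]].
Proof.
exists 1 => _ [L _ <-]; apply: le_trans (F1 (size u + L)).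
rewrite -(big_map (cat u) xpredT F); apply: ler_sum_uniq => //.
- rewrite map_inj_uniq ?strs_uniq // => x y /eqP.
  by rewrite eqseq_cat // eqxx => /eqP.
- exact: strs_uniq.
move=> w; rewrite filter_predT => /mapP[v]; rewrite mem_strs => vL ->.
by rewrite mem_strs size_cat ltn_add2l.
Qed.

Lemma ext_mass_ge L u : \sum_(v <- strs L) F (u ++ v) <= ext_mass F u.
Proof. by apply: ub_le_sup; [exact: ext_mass_has_ubound|exists L]. Qed.

Lemma ext_mass_le r u :
  (forall L, \sum_(v <- strs L) F (u ++ v) <= r) -> ext_mass F u <= r.
Proof.
move=> Fr; apply: ge_sup => [|_ [L _ <-]] //.
by exists (\sum_(v <- strs 0) F (u ++ v)); exists 0%N.
Qed.

Lemma ext_mass_ge0 u : 0 <= ext_mass F u.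
Proof. by have := ext_mass_ge 0 u; rewrite /strs big_nil. Qed.

Lemma ext_mass_nil : ext_mass F [::] <= 1.
Proof. exact: ext_mass_le. Qed.

Lemma ext_mass_self u : F u <= ext_mass F u.
Proof.
apply: le_trans (ext_mass_ge 1 u).
by rewrite big_strsS /strs !big_nil cats0 !addr0.
Qed.

(** Partial sums below both children fit into one at [u], a level deeper; the suprema are taken one
    child at a time. *)
Lemma ext_mass_children u :
  ext_mass F (rcons u false) + ext_mass F (rcons u true) <= ext_mass F u.
Proof.
rewrite -lerBrDr; apply: ext_mass_le => L1.
rewrite lerBrDr addrC -lerBrDr; apply: ext_mass_le => L2.
rewrite lerBrDr addrC.
apply: le_trans (ext_mass_ge (maxn L1 L2).+1 u).
rewrite big_strsS; apply: ler_wpDl => //.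
apply: lerD.
  under eq_bigr do rewrite cat_rcons.
  by apply: ler_sum_strs => //; exact: leq_maxl.
under eq_bigr do rewrite cat_rcons.
by apply: ler_sum_strs => //; exact: leq_maxr.
Qed.

End ExtMass.

(** Infinite sequences allow recursion on the length; [doubling_learner] pads its string with
    [false], and [yes_count_pre] shows that the padding is never read. *)
Fixpoint yes_count M (Y : cantor) k : nat :=
  if k is k'.+1 then
    (yes_count M Y k' + (2 ^+ (yes_count M Y k').+1 <= M (pre Y k))%R)%N
  else 0%N.

(* If [M [::] < 2] and [M] at most doubles at each step, then the number of yes
   answers is the integer part of [log2] of the running maximum of [M], or 0 if
   that is negative. *)
Definition doubling_learner M : learning_fun := fun u =>
  if size u is k.+1 then 2 ^+ (yes_count M (nth false u) k).+1 <= M u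
  else false.

Lemma pre_nth Y n k : (k <= n)%N -> pre (nth false (pre Y n)) k = pre Y k.
Proof.
move=> kn; apply/eq_in_map => i; rewrite mem_iota /= => ik.
by rewrite nth_mkseq // (leq_trans ik).
Qed.

Lemma yes_count_pre M Y n k : (k <= n)%N ->
  yes_count M (nth false (pre Y n)) k = yes_count M Y k.
Proof. by elim: k => //= k IH kn; rewrite pre_nth // IH // ltnW. Qed.

Lemma sum_doubling_learner M Y n :
  (\sum_(i < n.+1) doubling_learner M (pre Y i))%N = yes_count M Y n.
Proof.
elim: n => [|n IH]; first by rewrite big_ord1.
rewrite big_ord_recr IH /= /doubling_learner size_pre.
by rewrite yes_count_pre.
Qed.

(** As [M] at most doubles, a step passes at most one new power of 2, so one yes per step keeps
    up. *)
Lemma yes_count_upper M Y k :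
  M [::] < 2 -> (forall u b, M (rcons u b) <= 2 * M u) ->
  M (pre Y k) < 2 ^+ (yes_count M Y k).+1.
Proof.
move=> M2 MD; elim: k => [|k IH]; first by rewrite /= expr1.
rewrite /=; have [_|] := leP (2 ^+ (yes_count M Y k).+1) (M (pre Y k.+1));
  last by rewrite addn0.
rewrite addn1 exprS preS; apply: le_lt_trans (MD _ _) _.
by rewrite ltr_pM2l.
Qed.

(** The latest yes is the witness; with count 0, [M] might never reach 1. *)
Lemma yes_count_attained M Y k : (0 < yes_count M Y k)%N ->
  exists j, 2 ^+ yes_count M Y k <= M (pre Y j).
Proof.
elim: k => //= k IH.
have [Mk _|_] := leP (2 ^+ (yes_count M Y k).+1) (M (pre Y k.+1));
  last by rewrite /= addn0.
by exists k.+1; rewrite addn1.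
Qed.

(* Ville's inequality for the supermartingale [u |-> 2 ^ |u| * mu u], applied to
   the prefix-free set of first passages above [2 ^ n]. *)
Lemma doubling_learner_measure mu : (forall u, 0 <= mu u) ->
  (forall u, mu (rcons u false) + mu (rcons u true) <= mu u) ->
  mu [::] <= 1 ->
  measure_condition R (doubling_learner (fun u => 2 ^+ size u * mu u)).
Proof.
move=> mu0 musup mu1; set M := fun u => _ => -[|n].
  by rewrite expr0 invr1; exact/lambda_le/cover_bounded1.
apply: lambda_le.
pose V v := (2 ^+ n.+1 <= M v) && [forall i : 'I_(size v), M (take i v) < 2 ^+ n.+1].
have Vfree v w : V v -> V (v ++ w) -> w = [::].
  move=> /andP[Mv _]; case: w => // b w /andP[_ /forallP].
  have lt : (size v < size (v ++ b :: w))%N by rewrite size_cat /= addnS ltnS leq_addr.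
  by move=> /(_ (Ordinal lt)) /=; rewrite take_size_cat // ltNge Mv.
apply: (@cover_bounded_pred _ _ _ _ V) => [Y [[|k]]|L].
- by rewrite big_ord0.
- rewrite sum_doubling_learner => nk.
  have [j Mj] := yes_count_attained (leq_trans (ltn0Sn n) nk).
  have ex : exists j, 2 ^+ n.+1 <= M (pre Y j).
    by exists j; apply: le_trans Mj; rewrite ler_eXn2l // ltr1n.
  case: (ex_minnP ex) => m Mm mmin; exists m; rewrite /V Mm /=.
  apply/forallP => -[i /=]; rewrite size_pre => im.
  rewrite take_pre ?(ltnW im) // ltNge; apply/negP => /mmin.
  by rewrite leqNgt im.
under eq_bigr do rewrite powR2_1.
have := prefix_free_sum_le mu0 musup Vfree L [::] => /le_trans /(_ mu1) H.
rewrite -[leRHS]mulr1; apply: le_trans (ler_wpM2l _ H); last exact/ltW/pow2_gt0.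
(* [M v >= 2 ^+ n.+1] says that [2 ^- size v] is at most [2 ^- n.+1 * mu v]. *)
rewrite big_distrr /=; apply: ler_sum => v /andP[Mv _].
rewrite ler_pdivlMl ?exprn_gt0 // ler_pdivrMr ?exprn_gt0 //.
by rewrite mulrC; exact: Mv.
Qed.

End Supermartingales.

(** * From null sets to a learner *)

Section NullToLearning.
Context {R : realType}.
Implicit Types (P : pred bstring) (Gamma : set cantor) (s : R).

(** Each string of the [k]-th cover has weight at most [2 ^- k.+1], hence is long for large [k]; so
    the covers supply ever longer prefixes. *)
Lemma Hnull_infinitely_often Gamma s : 0 < s -> Hnull s Gamma ->
  exists W : pred bstring,
    (forall L, \sum_(w <- strs L | W w) 2 `^ (- (s * (size w)%:R)) <= 1) /\
    (forall X, Gamma X -> forall N, exists n, (N <= n)%N /\ W (pre X n)).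
Proof.
move=> s0 nullG.
have /choice[P PP] k := pred_cover_bounded (nullG (2 ^- k.+1) (pow2_gt0 _)).
exists (fun w => `[< exists k, P k w >]); split=> [L|X GX N].
  (* [f w] selects one cover containing [w], so the sum over the union is at most the double sum
     over covers. *)
  have [f fP] : {f : bstring -> nat & forall w, (exists k, P k w) -> P (f w) w}.
    apply: (@choice _ _ (fun w j => (exists k, P k w) -> P j w)) => w.
    by have [[k Pk]|nP] := pselect (exists k, P k w); [exists k|exists 0%N].
  pose K := (\max_(w <- strs L) f w).+1.
  apply: (@le_trans _ _ (\sum_(k < K) 2 ^- k.+1)); last first.
    suff -> : \sum_(k < K) 2 ^- k.+1 = 1 - 2 ^- K :> R.
      by rewrite gerBl; exact/ltW/pow2_gt0.
    elim: K => [|K IH]; first by rewrite big_ord0 expr0 invr1 subrr.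
    by rewrite big_ord_recr /= IH exprS invfM; lra.
  apply: (@le_trans _ _ (\sum_(k < K) \sum_(w <- strs L | P k w) 2 `^ (- (s * (size w)%:R)))).
    under [leRHS]eq_bigr do rewrite big_mkcond.
    rewrite exchange_big big_seq_cond [leRHS]big_seq_cond /= big_mkcondr.
    rewrite [leRHS]big_mkcondr.
    apply: ler_sum => w wL; case: asboolP => [/fP Pfw|_] /=; last first.
      by apply: sumr_ge0 => k _; case: ifP => // _; exact: powR_ge0.
    have fK : (f w < K)%N by rewrite ltnS (leq_bigmax_seq w).
    rewrite (bigD1 (Ordinal fK)) //= Pfw lerDl.
    by apply: sumr_ge0 => k _; case: ifP => // _; exact: powR_ge0.
  by apply: ler_sum => k _; exact: (PP k).2.
pose k := Num.bound (s * N%:R).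
have [n Pn] := (PP k).1 _ GX; exists n; split; last by apply/asboolP; exists k.
have small : 2 `^ (- (s * n%:R)) <= 2 ^- k.+1 :> R.
  apply: le_trans ((PP k).2 n.+1).
  have -> : 2 `^ (- (s * n%:R)) =
      \sum_(w <- [:: pre X n] | P k w) 2 `^ (- (s * (size w)%:R)).
    by rewrite big_cons Pn big_nil addr0 size_pre.
  apply: ler_sum_uniq; rewrite ?strs_uniq // => w.
  by rewrite mem_filter inE mem_strs => /andP[_ /eqP->]; rewrite size_pre.
rewrite leqNgt; apply/negP => nN.
have snk : s * n%:R <= k%:R.
  apply: le_trans (ltW (unstable.ltr_bound (s * N%:R))).
  by rewrite ler_wpM2l ?ler_nat ?ltW // ltnW.
have : 2 ^- k <= 2 `^ (- (s * n%:R)) :> R.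
  rewrite powRN lef_pV2 ?posrE ?powR_gt0 ?exprn_gt0 // -powR_mulrn //.
  by rewrite ler_powR // ler1n.
move=> /le_trans/(_ small); rewrite exprS invfM.
by have := @pow2_gt0 R k; lra.
Qed.

Lemma limn_esup_ge (u : nat -> R) (x : R) :
  (forall e N, 0 < e -> exists n, (N <= n)%N /\ x <= u n + e) ->
  (x%:E <= limn_esup (fun n => (u n)%:E))%E.
Proof.
move=> often; apply: le_ereal_inf_tmp => _ [V [N _ NV] <-].
apply/lee_addgt0Pr => e e0; have [n [Nn xn]] := often _ N e0.
apply: (@le_trans _ _ (u n + e)%:E); first by rewrite lee_fin.
rewrite EFinD leeD2r //; apply: ereal_sup_ubound.
by exists n => //; exact: NV.
Qed.

Lemma Hnull_learnG Gamma s : 0 < s -> Hnull s Gamma -> learnG R Gamma s.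
Proof.
move=> s0 /(Hnull_infinitely_often s0)[W [W1 Wio]]; split=> //.
pose F w : R := if W w then 2 `^ (- (s * (size w)%:R)) else 0.
have F0 w : 0 <= F w by rewrite /F; case: ifP => // _; exact: powR_ge0.
have F1 L : \sum_(w <- strs L) F w <= 1 by rewrite /F -big_mkcond.
pose M u := 2 ^+ size u * ext_mass F u.
have M2 : M [::] < 2.
  rewrite /M mul1r; apply: le_lt_trans (ext_mass_nil F1) _.
  by rewrite ltr1n.
have MD u b : M (rcons u b) <= 2 * M u.
  rewrite /M size_rcons exprS -mulrA !ler_wpM2l ?exprn_ge0 //.
  apply: le_trans (ext_mass_children F0 F1 u).
  by case: b; rewrite ?lerDl ?lerDr; exact: ext_mass_ge0.
exists (doubling_learner M) => X GX; split.
  apply: doubling_learner_measure.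
  - exact: ext_mass_ge0.
  - exact: ext_mass_children.
  - exact: ext_mass_nil.
apply: limn_esup_ge => e N e0.
(* [n >= 1 / e] makes [e * n] at least 1, absorbing the successor in [cn]. *)
have [n [Nn Wn]] := Wio _ GX (maxn N (Num.bound e^-1)).
exists n; split; first exact: leq_trans (leq_maxl _ _) Nn.
have en : 1 <= e * n%:R.
  rewrite mulrC -ler_pdivrMr // mul1r.
  apply: (le_trans (ltW (unstable.ltr_bound _))).
  by rewrite ler_nat; exact: leq_trans (leq_maxr _ _) Nn.
have n0 : 0 < n%:R :> R by rewrite -(pmulr_rgt0 _ e0); exact: lt_le_trans en.
(* Otherwise [M] at this prefix, at least [2 ^ ((1 - s) n)], would contradict [yes_count_upper]. *)
have cn : (1 - s) * n%:R <= (yes_count M X n).+1%:R.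
  rewrite leNgt; apply/negP => /ltW cn.
  have := yes_count_upper X n M2 MD; rewrite ltNge => /negP; apply.
  apply: (@le_trans _ _ (2 `^ ((1 - s) * n%:R))).
    by rewrite -powR_mulrn // ler_powR // ler1n.
  apply: (@le_trans _ _ (2 ^+ n * F (pre X n))).
    rewrite /F Wn size_pre -[2 ^+ n]powR_mulrn // -powRD ?pnatr_eq0 ?implybT //.
    by rewrite mulrBl mul1r.
  by rewrite /M size_pre ler_wpM2l ?exprn_ge0 // ext_mass_self.
rewrite AVG_count_yes count_yes_pre sum_doubling_learner size_pre.
rewrite -(ler_pM2r n0) [leRHS]mulrDl divfK ?gt_eqF //.
by apply: (le_trans cn); rewrite -addn1 natrD lerD2l.
Qed.

End NullToLearning.

Theorem mainTheorem6 (R : realType) (Gamma : set cantor) :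
  dimH R Gamma = inf (learnG R Gamma).
Proof.
(* Both infima are taken over sets containing 2, so neither is the default value for the empty
   set. *)
have null_nonempty : [set s : R | 0 <= s /\ Hnull s Gamma] !=set0.
  by exists 2; split => //; apply: Hnull_gt1; rewrite ltr1n.
have learn_nonempty : learnG R Gamma !=set0.
  by exists 2; apply: Hnull_learnG => //; apply: Hnull_gt1; rewrite ltr1n.
apply/le_anti/andP; split; apply: lb_le_inf => // s.
  move=> Gs; apply/ler_addgt0Pr => e e0; apply: ge_inf.
    by exists 0 => x [].
  split; first by rewrite addr_ge0 // ltW //; case: Gs.
  by apply: (learnG_Hnull Gs); rewrite ltrDl.
move=> [s0 nulls]; apply/ler_addgt0Pr => e e0; apply: ge_inf.
  by exists 0 => x [/ltW].
(* [s] may be 0, which [learnG] excludes; nullity passes to the larger exponent [s + e]. *)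
have se0 : 0 < s + e by rewrite ltr_wpDl.
apply: Hnull_learnG => // d d0.
have [P [covP Pd]] := pred_cover_bounded (nulls _ d0).
apply: (@cover_bounded_pred _ _ _ _ P) => // L; apply: le_trans (Pd L).
apply: ler_sum => w _; rewrite ler_powR ?ler1n // lerN2 ler_wpM2r //.
by rewrite lerDl ltW.
Qed.
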